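(* There does not exist a coherent labelling for a cube or a cuboid.
   Context: For a convex polyhedron, each face $F$ is oriented by the outward normal, so its boundary edges are traversed anticlockwise as seen from outside. A labelling of all the edges by integers is coherent if, for each face $F$ with $n_F$ edges, there is a choice of starting edge such that the successive labels read anticlockwise from that edge satisfy $a_1<a_2<\cdots<a_{n_F}$. *)

(* Defs.v *)
From mathcomp Require Import all_boot all_order all_algebra.
From mathcomp Require Import mathcomp_extra boolp classical_sets set_interval.
From mathcomp Require Import reals convex interval_inference.
From mathcomp Require Import ring lra.

Set Implicit Arguments.
Unset Strict Implicit.
Unset Printing Implicit Defensive.

Import Order.TTheory GRing.Theory Num.Theory.

Local Open Scope classical_set_scope.
Local Open Scope ring_scope.
Local Open Scope convex_scope.

Section Geometry.
Variable R : realType.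
Implicit Types (P F E : set 'rV[R]_3) (n p q u v w : 'rV[R]_3).

Definition dot u v : R := (u *m v^T) 0 0.

(* Index arithmetic is in the ring 'I_3, i.e. modulo 3. *)
Definition cross u v : 'rV[R]_3 :=
  \row_(i < 3) (u 0 (i + 1) * v 0 (i + 2) - u 0 (i + 2) * v 0 (i + 1)).

Definition segment p q : set 'rV[R]_3 :=
  [set (1 - t) *: p + t *: q | t in `[0, 1]].

Definition convex_hull (A : set 'rV[R]_3) : set 'rV[R]_3 :=
  smallest (@convex_set R 'rV[R]_3) A.

Definition convex_polyhedron P : Prop :=
  (exists s : seq 'rV[R]_3, P = convex_hull [set` s]) /\
  (exists a b c d : 'rV[R]_3,
     [/\ P a, P b, P c & P d] /\ dot (cross (b - a) (c - a)) (d - a) != 0).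

(* The part of P lying on its supporting plane with outward normal n. *)
Definition contact P n : set 'rV[R]_3 :=
  [set x | P x /\ forall y, P y -> dot n y <= dot n x].

(* F is a (two-dimensional) face of P, with outward normal n. *)
Definition is_face P n F : Prop :=
  [/\ n != 0, F = contact P n &
      exists x y z, [/\ F x, F y & F z] /\ cross (y - x) (z - x) != 0].

Definition is_edge P E : Prop :=
  exists n p q, [/\ n != 0, p != q, E = contact P n & E = segment p q].

(* vs lists the vertices of the face F of P anticlockwise as seen from the
   outside: the sides [v, next vs v] are exactly the edges of P in F, and F
   lies to the left of each directed side when looked at against n. *)
Definition anticlockwise_boundary P n F (vs : seq 'rV[R]_3) : Prop :=
  [/\ uniq vs,
      [set E | is_edge P E /\ E `<=` F] =
        [set segment v (next vs v) | v in [set` vs]] &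
      forall v x, v \in vs -> F x ->
        0 <= dot n (cross (next vs v - v) (x - v))].

(* A labelling is a function on all subsets of space, of which only the values
   on the edges of P are ever used; labels of distinct edges may coincide.
   The choice of a starting edge is the choice of a rotation of vs. *)
Definition coherent_labelling P (l : set 'rV[R]_3 -> int) : Prop :=
  forall n F, is_face P n F ->
  forall vs, anticlockwise_boundary P n F vs ->
  exists k : nat,
    sorted <%R (rot k [seq l (segment v (next vs v)) | v <- vs]).

Definition box (o u v w : 'rV[R]_3) : set 'rV[R]_3 :=
  [set x | exists r s t : R,
     [/\ 0 <= r <= 1, 0 <= s <= 1 & 0 <= t <= 1] /\
     x = o + r *: u + s *: v + t *: w].

Definition orthogonal_frame u v w : Prop :=
  [/\ u != 0, v != 0 & w != 0] /\
  [/\ dot u v = 0, dot v w = 0 & dot w u = 0].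

Definition is_cuboid P : Prop :=
  exists o u v w, orthogonal_frame u v w /\ P = box o u v w.

Definition is_cube P : Prop :=
  exists o u v w, [/\ orthogonal_frame u v w,
    dot u u = dot v v, dot v v = dot w w & P = box o u v w].

Lemma dotE u v : dot u v = u 0 0 * v 0 0 + u 0 1 * v 0 1 + u 0 2 * v 0 2.
Proof.
rewrite /dot mxE !big_ord_recl big_ord0 !mxE addr0 addrA.
by congr (_ + _ * _ + _ * _); congr (_ _ _); apply/val_inj.
Qed.

Lemma cross_dotE u v w : dot (cross u v) w =
  (u 0 1 * v 0 2 - u 0 2 * v 0 1) * w 0 0 +
  (u 0 2 * v 0 0 - u 0 0 * v 0 2) * w 0 1 +
  (u 0 0 * v 0 1 - u 0 1 * v 0 0) * w 0 2.
Proof.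
rewrite dotE !mxE.
have -> : 0 + 1 = 1 :> 'I_3 by apply/val_inj.
have -> : 0 + 2 = 2 :> 'I_3 by apply/val_inj.
have -> : 1 + 1 = 2 :> 'I_3 by apply/val_inj.
have -> : 1 + 2 = 0 :> 'I_3 by apply/val_inj.
have -> : 2 + 1 = 0 :> 'I_3 by apply/val_inj.
by have -> : 2 + 2 = 1 :> 'I_3 by apply/val_inj.
Qed.

Lemma dot_eq0 u : (dot u u == 0) = (u == 0).
Proof.
apply/eqP/eqP => [|->]; last by rewrite dotE !mxE; ring.
rewrite dotE => h; apply/rowP => i; rewrite mxE.
have h0 : u 0 0 = 0 by nra.
have h1 : u 0 1 = 0 by nra.
have h2 : u 0 2 = 0 by nra.
case: i => [[|[|[|//]]]] hi; [move: h0|move: h1|move: h2] => <-;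
  by congr (u _ _); apply/val_inj.
Qed.

Lemma frame_triple_neq0 u v w :
  orthogonal_frame u v w -> dot (cross u v) w != 0.
Proof.
move=> [[u0 v0 w0] [uv vw wu]].
have gram : dot (cross u v) w ^+ 2 =
    dot u u * dot v v * dot w w + 2 * dot u v * dot v w * dot w u
    - dot u u * dot v w ^+ 2 - dot v v * dot w u ^+ 2
    - dot w w * dot u v ^+ 2.
  by rewrite cross_dotE !dotE; ring.
rewrite -sqrf_eq0 gram uv vw wu !expr0n /= !mulr0 !subr0 addr0.
by rewrite !mulf_neq0 ?dot_eq0.
Qed.

Definition corners o u v w : seq 'rV[R]_3 :=
  [:: o; o + u; o + v; o + u + v;
      o + w; o + u + w; o + v + w; o + u + v + w].

Lemma box_hull o u v w : box o u v w = convex_hull [set` corners o u v w].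
Proof.
apply/seteqP; split=> [x [r [s [t [[r01 s01 t01] ->]]]]|].
  move=> C [cC sC].
  have cv p q (k : R) : 0 <= k <= 1 -> C p -> C q -> C (p + k *: (q - p)).
    move=> k01 Cp Cq.
    have kI : Itv.spec (@Itv.num_sem R) (Itv.Real `[0%Z, 1%Z]) k.
      rewrite /= /Itv.num_sem realE/= in_itv/=.
      by case/andP: k01 => k0 k1; rewrite k0 k1.
    have := cC q p (Itv.mk kI); rewrite !inE => /(_ Cq Cp).
    rewrite /conv/=.
    suff -> : p + k *: (q - p) = k *: q + (1 - k) *: p by [].
    by apply/rowP => i; rewrite !mxE; ring.
  have S p : p \in corners o u v w -> C p by move=> ?; apply: sC.
  have [? ? ? ?] : [/\ C (o + r *: u), C (o + v + r *: u),
      C (o + w + r *: u) & C (o + v + w + r *: u)].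
    split.
    - have -> : o + r *: u = o + r *: (o + u - o).
        by apply/rowP => i; rewrite !mxE; ring.
      by apply: cv => //; apply: S; rewrite !inE eqxx ?orbT.
    - have -> : o + v + r *: u = o + v + r *: (o + u + v - (o + v)).
        by apply/rowP => i; rewrite !mxE; ring.
      by apply: cv => //; apply: S; rewrite !inE eqxx ?orbT.
    - have -> : o + w + r *: u = o + w + r *: (o + u + w - (o + w)).
        by apply/rowP => i; rewrite !mxE; ring.
      by apply: cv => //; apply: S; rewrite !inE eqxx ?orbT.
    - have -> : o + v + w + r *: u =
          o + v + w + r *: (o + u + v + w - (o + v + w)).
        by apply/rowP => i; rewrite !mxE; ring.
      by apply: cv => //; apply: S; rewrite !inE eqxx ?orbT.
  have -> : o + r *: u + s *: v + t *: w =
    (o + r *: u + s *: (o + v + r *: u - (o + r *: u))) + t *: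
    ((o + w + r *: u + s *: (o + v + w + r *: u - (o + w + r *: u))) -
     (o + r *: u + s *: (o + v + r *: u - (o + r *: u)))).
    by apply/rowP => i; rewrite !mxE; ring.
  by apply: (cv) => //; apply: cv.
apply: smallest_sub.
  move=> x y k; rewrite !inE => -[r [s [t [[r01 s01 t01] ->]]]].
  move=> [r' [s' [t' [[r01' s01' t01'] ->]]]].
  have k0 : 0 <= k%:num by []. have k1 : k%:num <= 1 by [].
  exists (k%:num * r + (1 - k%:num) * r'), (k%:num * s + (1 - k%:num) * s'),
    (k%:num * t + (1 - k%:num) * t').
  split; first by split; apply/andP; split; nra.
  have -> : forall p q : 'rV[R]_3,
      (p : convex_lmodType _) <| k |> q = k%:num *: p + (1 - k%:num) *: q.
    by [].
  by apply/rowP => i; rewrite !mxE; ring.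
have I (b : bool) : 0 <= (b%:R : R) <= 1 by case: b; rewrite /= lexx ler01.
have B (a b c : bool) :
    box o u v w (o + a%:R *: u + b%:R *: v + c%:R *: w).
  by exists a%:R, b%:R, c%:R.
move=> x; rewrite /= !inE => h.
have := (B false false false, B true false false, B false true false,
  B true true false, B false false true, B true false true,
  B false true true, B true true true).
rewrite /= !scale0r !scale1r !addr0 => -[[[[[[[? ?] ?] ?] ?] ?] ?] ?].
by move: h; do 7!(case/orP => [/eqP -> //|]); move=> /eqP ->.
Qed.

Lemma cuboid_convex_polyhedron P : is_cuboid P -> convex_polyhedron P.
Proof.
move=> [o [u [v [w [fr ->]]]]]; split.
  by exists (corners o u v w); exact: box_hull.
exists o, (o + u), (o + v), (o + w); split.
  rewrite box_hull; split; apply: sub_gen_smallest;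
  by rewrite /= !inE eqxx ?orbT.
by rewrite !(addrC o) !addrK frame_triple_neq0.
Qed.

End Geometry.

(* Main.v *)
Require Import Defs.
From mathcomp Require Import all_boot all_order all_algebra.
From mathcomp Require Import classical_sets reals.
From mathcomp Require Import ring lra zify.

(** Call a corner of a face, that is, a vertex of the face together with the
    edge entering it and the edge leaving it anticlockwise, a descent when the
    label does not strictly increase from the first edge to the second.

    On a coherently labelled face the labels increase strictly at every corner
    except possibly where the last edge meets the starting one, so each face
    carries at most one descent.  On the other hand, if [a], [b], [c] are the
    three edges at a vertex of a box, in the appropriate cyclic order, then the
    three faces there have the corners [a -> b], [b -> c] and [c -> a]; these
    cannot all be strict increases, so each vertex carries at least one
    descent.  Summing over the corners of the box gives at least 8 descents by
    vertices but at most 6 by faces ([no_coherent_corners]).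

    The remaining work is geometric: identifying the faces and the edges of a
    box.  A linear form on a box is maximised coordinate by coordinate
    ([box_contactP]), so its contact set is a vertex, an edge or a face
    according to how many of the three spanning vectors the form annihilates.
    This determines the anticlockwise boundary of the face with outward normal
    [w] ([top_boundary]), and the other five faces follow by reparametrising the
    box. *)

Import Order.TTheory GRing.Theory Num.Theory.

Local Open Scope classical_set_scope.
Local Open Scope ring_scope.

(** * Counting descents *)

Section Descents.
Set Implicit Arguments.
Unset Strict Implicit.
Variables (T : Type) (e : T -> T -> int).

(** The number (0 or 1) of descents at the corner [a, p, b], where [e x y] is
    the label of the edge joining [x] and [y]. *)
Definition descent (a p b : T) : nat := ~~ (e a p < e p b).

(** The number of descents around the face with vertices [p1, p2, p3, p4], listed
    anticlockwise. *)
Definition face_descents (p1 p2 p3 p4 : T) : nat :=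
  (descent p1 p2 p3 + descent p2 p3 p4 + descent p3 p4 p1 + descent p4 p1 p2)%N.

(** If the labels increase from some starting edge on, only the corner entering
    that edge can be a descent. *)
Lemma sorted_rot_descents p1 p2 p3 p4 k :
  sorted <%R (rot k [:: e p1 p2; e p2 p3; e p3 p4; e p4 p1]) ->
  (face_descents p1 p2 p3 p4 <= 1)%N.
Proof.
rewrite /face_descents /descent.
case: k => [|[|[|[|k]]]] /=; rewrite ?andbT => /and3P[-> -> ->];
  by rewrite ?addn0 ?add0n ?leq_b1.
Qed.

Hypothesis eC : forall a b, e a b = e b a.

(** Otherwise the labels at [p] would satisfy [a < b < c < a]. *)
Lemma vertex_descents a b c p :
  (1 <= descent a p b + descent b p c + descent c p a)%N.
Proof.
rewrite /descent (eC b p) (eC c p) (eC a p).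
have [ab|//] := ltP (e p a) (e p b); have [bc|//] := ltP (e p b) (e p c).
by have := lt_trans ab bc; rewrite lt_neqAle => /andP[_]; case: ltP.
Qed.

(** [xijk] stands for the corner of the box with coordinates [i, j, k]; the
    faces are listed in the order x, y, z, upper face first. *)
Lemma no_coherent_corners x000 x100 x010 x110 x001 x101 x011 x111 :
  (face_descents x100 x110 x111 x101 <= 1)%N ->
  (face_descents x000 x001 x011 x010 <= 1)%N ->
  (face_descents x010 x011 x111 x110 <= 1)%N ->
  (face_descents x000 x100 x101 x001 <= 1)%N ->
  (face_descents x001 x101 x111 x011 <= 1)%N ->
  (face_descents x000 x010 x110 x100 <= 1)%N -> False.
Proof.
rewrite /face_descents.
have := vertex_descents x001 x100 x010 x000.
have := vertex_descents x110 x000 x101 x100.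
have := vertex_descents x011 x000 x110 x010.
have := vertex_descents x010 x100 x111 x110.
have := vertex_descents x101 x000 x011 x001.
have := vertex_descents x100 x001 x111 x101.
have := vertex_descents x111 x001 x010 x011.
have := vertex_descents x110 x101 x011 x111.
lia.
Qed.

End Descents.

(** * Contact sets of a box *)

Local Ltac vec := apply/rowP => i; rewrite !mxE; ring.

Section Box.
Set Implicit Arguments.
Unset Strict Implicit.
Variable R : realType.
Implicit Types (o u v w n p q x : 'rV[R]_3) (a r s t : R).

Lemma dotDr n p q : dot n (p + q) = dot n p + dot n q.
Proof. by rewrite !dotE !mxE; ring. Qed.

Lemma dotC p q : dot p q = dot q p.
Proof. by rewrite !dotE; ring. Qed.

Lemma dotNr n p : dot n (- p) = - dot n p.
Proof. by rewrite !dotE !mxE; ring. Qed.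

Lemma dot0r n : dot n 0 = 0.
Proof. by rewrite !dotE !mxE; ring. Qed.

Lemma dot_gt0 u : u != 0 -> 0 < dot u u.
Proof.
rewrite -dot_eq0 lt_def => -> /=.
by rewrite dotE; nra.
Qed.

Lemma segmentC p q : segment p q = segment q p.
Proof.
have S p1 q1 : segment p1 q1 `<=` segment q1 p1.
  move=> _ [t /= t01 <-]; exists (1 - t); last by vec.
  by move: t01; rewrite /= !in_itv /=; lra.
by apply/seteqP; split; exact: S.
Qed.

Lemma box_swap o u v w : box o u v w = box o v u w.
Proof.
have S u1 v1 : box o u1 v1 w `<=` box o v1 u1 w.
  move=> _ [r [s [t [[hr hs ht] ->]]]]; exists s, r, t; split=> //; vec.
by apply/seteqP; split; exact: S.
Qed.

Lemma box_rot o u v w : box o u v w = box o v w u.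
Proof.
by apply/seteqP; split=> _ [r [s [t [[hr hs ht] ->]]]];
  [exists s, t, r|exists t, r, s]; split=> //; vec.
Qed.

Lemma box_flip o u v w : box o u v w = box (o + w) v u (- w).
Proof.
by apply/seteqP; split=> _ [r [s [t [[hr hs ht] ->]]]];
  exists s, r, (1 - t); split; try (by split=> //; lra); vec.
Qed.

(** [r] maximises the linear function of slope [a] on the unit interval. *)
Definition maximises a r := forall r', 0 <= r' <= 1 -> r' * a <= r * a.

Lemma maximises_cst r : maximises 0 r.
Proof. by move=> r' _; rewrite !mulr0. Qed.

Lemma maximises_gt0 a r : 0 < a -> 0 <= r <= 1 -> maximises a r <-> r = 1.
Proof.
move=> a0 r01; split=> [/(_ 1)|-> r' r'01]; last by nra.
by rewrite lexx ler01 => /(_ isT); nra.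
Qed.

Lemma maximises_lt0 a r : a < 0 -> 0 <= r <= 1 -> maximises a r <-> r = 0.
Proof.
move=> a0 r01; split=> [/(_ 0)|-> r' r'01]; last by nra.
by rewrite lexx ler01 => /(_ isT); nra.
Qed.

Lemma ex_maximises a : exists r, 0 <= r <= 1 /\ maximises a r.
Proof.
have [a0|a0] := leP 0 a.
  by exists 1; split=> [|r' r'01]; [lra|nra].
by exists 0; split=> [|r' r'01]; [lra|nra].
Qed.

Lemma box_contactP o u v w n x : contact (box o u v w) n x <->
  exists r s t, [/\ 0 <= r <= 1, 0 <= s <= 1 & 0 <= t <= 1] /\
    [/\ maximises (dot n u) r, maximises (dot n v) s, maximises (dot n w) t
      & x = o + r *: u + s *: v + t *: w].
Proof.
have E r s t : dot n (o + r *: u + s *: v + t *: w) =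
    dot n o + r * dot n u + s * dot n v + t * dot n w.
  by rewrite !dotE !mxE; ring.
split=> [[[r [s [t [[hr hs ht] ->]]]] mx]|].
  exists r, s, t; split; split=> // k hk.
  - have /mx : box o u v w (o + k *: u + s *: v + t *: w) by exists k, s, t.
    by rewrite !E; lra.
  - have /mx : box o u v w (o + r *: u + k *: v + t *: w) by exists r, k, t.
    by rewrite !E; lra.
  - have /mx : box o u v w (o + r *: u + s *: v + k *: w) by exists r, s, k.
    by rewrite !E; lra.
move=> [r [s [t [[hr hs ht] [mr ms mt ->]]]]]; split; first by exists r, s, t.
move=> _ [r' [s' [t' [[hr' hs' ht'] ->]]]]; rewrite !E.
by have := (mr _ hr', ms _ hs', mt _ ht') => -[[]]; lra.
Qed.

(** The upper face of the box, lying in the plane [o + w + <u, v>]. *)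
Lemma contact_face o u v w n :
  dot n u = 0 -> dot n v = 0 -> 0 < dot n w ->
  contact (box o u v w) n =
  [set x | exists r s, [/\ 0 <= r <= 1, 0 <= s <= 1 &
                           x = o + w + r *: u + s *: v]].
Proof.
move=> nu nv nw; apply/seteqP; split=> x.
  move=> /box_contactP[r [s [t [[hr hs ht] [_ _ + ->]]]]].
  by move=> /(maximises_gt0 nw ht) ->; exists r, s; split=> //; vec.
move=> [r [s [hr hs ->]]]; apply/box_contactP; exists r, s, 1.
have h1 : 0 <= (1 : R) <= 1 by lra.
split=> //; rewrite nu nv; split; try exact: maximises_cst.
  exact/(maximises_gt0 nw).
by vec.
Qed.

Lemma contact_edge o u v w n :
  dot n u = 0 -> 0 < dot n v -> 0 < dot n w ->
  contact (box o u v w) n = segment (o + w + v) (o + w + v + u).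
Proof.
move=> nu nv nw; apply/seteqP; split=> x.
  move=> /box_contactP[r [s [t [[hr hs ht] [_ + + ->]]]]].
  move=> /(maximises_gt0 nv hs) -> /(maximises_gt0 nw ht) ->.
  by exists r => /=; [rewrite in_itv|vec].
move=> [r /=]; rewrite in_itv /= => hr <-.
apply/box_contactP; exists r, 1, 1.
have h1 : 0 <= (1 : R) <= 1 by lra.
split=> //; rewrite nu; split; first exact: maximises_cst.
- exact/(maximises_gt0 nv).
- exact/(maximises_gt0 nw).
- by vec.
Qed.

Lemma contact_edgeN o u v w n :
  dot n u = 0 -> dot n v < 0 -> 0 < dot n w ->
  contact (box o u v w) n = segment (o + w) (o + w + u).
Proof.
move=> nu nv nw.
rewrite box_swap box_rot box_flip box_swap contact_edge //; last first.
  by rewrite dotNr oppr_gt0.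
by congr segment; vec.
Qed.

(** A linear form annihilating none of the spanning vectors is maximal at a
    single point of the box. *)
Lemma contact_vertex o u v w n : dot n u != 0 -> dot n v != 0 ->
  dot n w != 0 -> exists p, contact (box o u v w) n `<=` [set p].
Proof.
have U a : a != 0 -> exists r, forall r', 0 <= r' <= 1 -> maximises a r' ->
    r' = r.
  rewrite neq_lt => /orP[a0|a0]; [exists 0|exists 1] => r' hr.
    by move/(maximises_lt0 a0 hr).
  by move/(maximises_gt0 a0 hr).
move=> /U[r hr] /U[s hs] /U[t ht].
exists (o + r *: u + s *: v + t *: w) => x.
move=> /box_contactP[r' [s' [t' [[r01 s01 t01] [mr ms mt ->]]]]].
by rewrite (hr r') // (hs s') // (ht t').
Qed.

(** A contact set contained in the upper face has a normal pointing upwards. *)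
Lemma contact_sub_top o u v w n : 0 < dot w w ->
  dot w u = 0 -> dot w v = 0 ->
  contact (box o u v w) n `<=` contact (box o u v w) w -> 0 < dot n w.
Proof.
move=> ww wu wv sub; rewrite ltNge; apply/negP => nw.
have [r [hr mr]] := ex_maximises (dot n u).
have [s [hs ms]] := ex_maximises (dot n v).
(* If [n] does not increase along [w], its contact set meets the bottom face. *)
have : contact (box o u v w) n (o + r *: u + s *: v + 0 *: w).
  apply/box_contactP; exists r, s, 0; split; first by split=> //; lra.
  by split=> // t ht; nra.
move=> /sub[_ /(_ (o + r *: u + s *: v + 1 *: w))].
have E t : dot w (o + r *: u + s *: v + t *: w) =
    dot w o + r * dot w u + s * dot w v + t * dot w w.
  by rewrite !dotE !mxE; ring.
have h : box o u v w (o + r *: u + s *: v + 1 *: w).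
  by exists r, s, 1; split=> //; split=> //; lra.
by move=> /(_ h); rewrite !E; lra.
Qed.

(** The vertices [x], [x + u], [x + v] of a right angle do not all lie on one
    segment. *)
Lemma segment_no_corner p q x u v : dot u v = 0 -> u != 0 -> v != 0 ->
  segment p q x -> segment p q (x + u) -> ~ segment p q (x + v).
Proof.
move=> uv u0 v0 [a _ ax] [b _ bx] [c _ cx].
have uE : u = (b - a) *: (q - p).
  by rewrite -(addKr x u) -bx -ax; vec.
have vE : v = (c - a) *: (q - p).
  by rewrite -(addKr x v) -cx -ax; vec.
move: uv.
have -> : dot u v = (b - a) * (c - a) * dot (q - p) (q - p).
  by rewrite uE vE !dotE !mxE; ring.
move=> /eqP; rewrite !mulf_eq0 dot_eq0 => /orP[/orP[]|] /eqP h.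
- by move: u0; rewrite uE h scale0r eqxx.
- by move: v0; rewrite vE h scale0r eqxx.
- by move: v0; rewrite vE h scaler0 eqxx.
Qed.

(** * The upper face of a box *)

Lemma frame_rot u v w : orthogonal_frame u v w -> orthogonal_frame v w u.
Proof. by move=> [[? ? ?] [? ? ?]]; split. Qed.

Lemma frame_swap u v w : orthogonal_frame u v w -> orthogonal_frame v u w.
Proof. by move=> [[? ? ?] [? ? ?]]; split; split=> //; rewrite dotC. Qed.

Lemma frame_flip u v w : orthogonal_frame u v w -> orthogonal_frame v u (- w).
Proof.
move=> [[u0 v0 w0] [uv vw wu]]; split; first by rewrite oppr_eq0.
by split; [rewrite dotC|rewrite dotNr dotC wu oppr0|
  rewrite dotC dotNr vw oppr0].
Qed.

(** The vertices of the upper face [o + w + <u, v>], anticlockwise as seen from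
    the tip of [w] when the frame is right-handed. *)
Definition top_vertices o u v w : seq 'rV[R]_3 :=
  [:: o + w; o + w + u; o + w + u + v; o + w + v].

Section TopFace.
Variables o u v w : 'rV[R]_3.
Hypothesis fr : orthogonal_frame u v w.

Lemma top_face : is_face (box o u v w) w (contact (box o u v w) w).
Proof.
have [[u0 v0 w0] [uv vw wu]] := fr.
have wv : dot w v = 0 by rewrite dotC.
split=> //; exists (o + w), (o + w + u), (o + w + v).
rewrite (contact_face o wu wv (dot_gt0 w0)); split.
  split; [exists 0, 0|exists 1, 0|exists 0, 1];
    by split; rewrite ?lexx ?ler01 //; vec.
rewrite !(addrC (o + w)) !addrK.
apply: contra_neq (frame_triple_neq0 fr) => ->.
by rewrite dotC dot0r.
Qed.

Lemma top_uniq : uniq (top_vertices o u v w).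
Proof.
have [[u0 v0 _] [uv _ _]] := fr.
have uv0 : u + v != 0.
  by apply: contra_neq u0 => /(congr1 (dot u)); rewrite dotDr uv dot0r addr0;
    move=> /eqP; rewrite dot_eq0 => /eqP.
have ne : u != v.
  by apply: contra_neq u0 => uvE; move: uv; rewrite -uvE => /eqP;
    rewrite dot_eq0 => /eqP.
have sub d p q : d != 0 -> d = p - q -> p != q.
  by move=> d0 dE; rewrite -subr_eq0 -dE.
have [nu nv nuv] : [/\ - u != 0, - v != 0 & - (u + v) != 0].
  by rewrite !oppr_eq0.
rewrite /= !inE !negb_or !andbT.
apply/and3P; split; [apply/and3P; split|apply/andP; split|].
- by apply: (sub _ _ _ nu); vec.
- by apply: (sub _ _ _ nuv); vec.
- by apply: (sub _ _ _ nv); vec.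
- by apply: (sub _ _ _ nv); vec.
- by apply: (sub (u - v)); [rewrite subr_eq0|vec].
- by apply: (sub _ _ _ u0); vec.
Qed.

(** The sides of the upper face, in the order of [top_vertices]. *)
Definition top_sides : set (set 'rV[R]_3) :=
  [set E | [\/ E = segment (o + w) (o + w + u),
               E = segment (o + w + u) (o + w + u + v),
               E = segment (o + w + u + v) (o + w + v) |
               E = segment (o + w + v) (o + w)]].

Lemma mem_top_vertices x : (x \in top_vertices o u v w) =
  [|| x == o + w, x == o + w + u, x == o + w + u + v | x == o + w + v].
Proof. by rewrite !inE. Qed.

Lemma next_top : [/\ next (top_vertices o u v w) (o + w) = o + w + u,
  next (top_vertices o u v w) (o + w + u) = o + w + u + v,
  next (top_vertices o u v w) (o + w + u + v) = o + w + v &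
  next (top_vertices o u v w) (o + w + v) = o + w].
Proof.
have := top_uniq; rewrite /= !inE !negb_or !andbT.
move=> /and3P[/and3P[n1 n2 n3] /andP[n4 n5] n6].
rewrite eq_sym in n1; rewrite eq_sym in n2; rewrite eq_sym in n3.
rewrite eq_sym in n4; rewrite eq_sym in n5; rewrite eq_sym in n6.
rewrite !eqxx.
by rewrite !(negPf n1, negPf n2, negPf n3, negPf n4, negPf n5, negPf n6).
Qed.

Lemma top_sidesE : [set segment x (next (top_vertices o u v w) x) |
  x in [set` top_vertices o u v w]] = top_sides.
Proof.
have [n1 n2 n3 n4] := next_top.
apply/seteqP; split=> E.
  move=> [x + <-]; rewrite [X in X -> _]/= mem_top_vertices.
  case/or4P => /eqP ->; rewrite ?n1 ?n2 ?n3 ?n4;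
    [exact: Or41|exact: Or42|exact: Or43|exact: Or44].
case=> ->; [exists (o + w)|exists (o + w + u)|exists (o + w + u + v)|
  exists (o + w + v)]; rewrite ?n1 ?n2 ?n3 ?n4 //=;
  by rewrite mem_top_vertices eqxx ?orbT.
Qed.

(** A linear form strictly increasing along [w] and annihilating exactly one of
    [u], [v] touches the box in a side of the upper face. *)
Lemma contact_top_side n : 0 < dot n w ->
  (dot n u == 0) != (dot n v == 0) -> top_sides (contact (box o u v w) n).
Proof.
move=> nw; have [nu /=|nu] := eqVneq (dot n u) 0.
  move=> nv; have : dot n v != 0 by move: nv; case: (dot n v == 0).
  rewrite neq_lt => /orP[{}nv|{}nv].
    by apply: Or41; exact: contact_edgeN.
  apply: Or43; rewrite segmentC (contact_edge o nu nv nw).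
  by congr segment; vec.
move=> /=; case: (eqVneq (dot n v) 0) => //= nv _.
move: nu; rewrite neq_lt => /orP[nu|nu]; rewrite box_swap.
  by apply: Or44; rewrite segmentC; exact: contact_edgeN.
by apply: Or42; exact: contact_edge.
Qed.

Lemma top_side_normal E : top_sides E -> exists n, [/\ 0 < dot n w,
  (dot n u == 0) != (dot n v == 0) & E = contact (box o u v w) n].
Proof.
have [[/dot_gt0 u0 /dot_gt0 v0 /dot_gt0 w0] [uv vw wu]] := fr.
have vu : dot v u = 0 by rewrite dotC.
have wv : dot w v = 0 by rewrite dotC.
have uw : dot u w = 0 by rewrite dotC.
have D x y z : dot (x + y) z = dot x z + dot y z.
  by rewrite dotC dotDr !(dotC z).
have N x z : dot (- x) z = - dot x z by rewrite dotC dotNr dotC.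
have dots := (D, N, uv, vw, wu, vu, wv, uw, oppr0, addr0, add0r).
(* The normal is that of the upper face tilted towards the side. *)
case=> ->; [exists (w - v)|exists (w + u)|exists (w + v)|exists (w - u)];
  rewrite !dots;
  rewrite ?oppr_eq0 ?eqxx ?(gt_eqF u0) ?(gt_eqF v0); split=> //.
- by rewrite contact_edgeN ?dots ?oppr_lt0.
- by rewrite box_swap contact_edge ?dots.
- rewrite contact_edge ?dots //.
  by rewrite segmentC; congr segment; vec.
- rewrite box_swap contact_edgeN ?dots ?oppr_lt0 //.
  exact: segmentC.
Qed.

Lemma top_edges : [set E | is_edge (box o u v w) E /\
  E `<=` contact (box o u v w) w] = top_sides.
Proof.
have [[u0 v0 w0] [uv vw wu]] := fr.
have wv : dot w v = 0 by rewrite dotC.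
have ww := dot_gt0 w0.
apply/seteqP; split=> E.
  move=> [[n [p [q [n0 pq EC ES]]]]]; rewrite {1}EC => sub.
  have nw := contact_sub_top ww wu wv sub.
  rewrite EC; apply: contact_top_side => //.
  apply/negP => /eqP; have [nu /esym/eqP nv|nu /esym/negbT nv] := eqVneq.
    (* The form is constant on the upper face, which is not a segment. *)
    move: EC; rewrite (contact_face o nu nv nw) ES => FE.
    apply: (@segment_no_corner p q (o + w) u v uv u0 v0); rewrite FE;
      [exists 0, 0|exists 1, 0|exists 0, 1];
      by split; rewrite ?lexx ?ler01 //; vec.
  have [x sx] := contact_vertex o nu nv (lt0r_neq0 nw).
  move: pq; rewrite -EC ES in sx.
  have -> : p = x.
    by apply: sx; exists 0; [rewrite /= in_itv /= lexx ler01|vec].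
  have -> : q = x.
    by apply: sx; exists 1; [rewrite /= in_itv /= lexx ler01|vec].
  by rewrite eqxx.
move=> tE; split.
  have [n [nw _ EC]] := top_side_normal tE.
  have n0 : n != 0.
    by apply: contraTneq nw => ->; rewrite dotC dot0r ltxx.
  have [d1 d2 d3 d4] : [/\ (o + w != o + w + u), (o + w + u != o + w + u + v),
      (o + w + u + v != o + w + v) & (o + w + v != o + w)].
    have := top_uniq; rewrite /= !inE !negb_or !andbT.
    move=> /and3P[/and3P[n1 n2 n3] /andP[n4 n5] n6].
    by split=> //; rewrite eq_sym.
  by case: tE => ES; exists n; do 2!eexists; split; try exact: ES.
rewrite (contact_face o wu wv ww).
by case: tE => -> x [r /=]; rewrite in_itv /= => hr <-;
  [exists r, 0|exists 1, r|exists (1 - r), 1|exists 0, (1 - r)];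
  (split; [lra|lra|vec]).
Qed.

(** Positivity of the frame makes [top_vertices] run anticlockwise. *)
Lemma top_boundary : 0 < dot (cross u v) w ->
  anticlockwise_boundary (box o u v w) w (contact (box o u v w) w)
    (top_vertices o u v w).
Proof.
move=> pos; have [[u0 v0 w0] [uv vw wu]] := fr.
have wv : dot w v = 0 by rewrite dotC.
split; [exact: top_uniq|by rewrite top_edges top_sidesE|].
move=> x y; rewrite (contact_face o wu wv (dot_gt0 w0)) => + [r [s [hr hs ->]]].
have [n1 n2 n3 n4] := next_top.
(* The triple product is the volume of the frame times the coordinate
   distance from the point to the side. *)
have vol c p q k : dot (cross p q) w = c * dot (cross u v) w ->
    0 <= c -> k = cross p q -> 0 <= dot w k.
  by move=> E c0 ->; rewrite dotC E mulr_ge0 // ltW.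
rewrite mem_top_vertices => /or4P[] /eqP ->; rewrite ?n1 ?n2 ?n3 ?n4.
- apply: (vol s); [|lra|reflexivity].
  by rewrite !cross_dotE !mxE; ring.
- apply: (vol (1 - r)); [|lra|reflexivity].
  by rewrite !cross_dotE !mxE; ring.
- apply: (vol (1 - s)); [|lra|reflexivity].
  by rewrite !cross_dotE !mxE; ring.
- apply: (vol r); [|lra|reflexivity].
  by rewrite !cross_dotE !mxE; ring.
Qed.

End TopFace.

(** * Coherent labellings of a box *)

(** The label of the edge joining [p] and [q]. *)
Definition edge_label (l : set 'rV[R]_3 -> int) p q := l (segment p q).

(** The corners are left as variables so that, up to rewriting, the six faces of
    one box, each upper for its own parametrisation of that box, share their
    vertices. *)
Lemma coherent_top P l o u v w p1 p2 p3 p4 : coherent_labelling P l ->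
  P = box o u v w -> orthogonal_frame u v w -> 0 < dot (cross u v) w ->
  p1 = o + w -> p2 = o + w + u -> p3 = o + w + u + v -> p4 = o + w + v ->
  (face_descents (edge_label l) p1 p2 p3 p4 <= 1)%N.
Proof.
move=> coh PE fr pos -> -> -> ->; subst P.
have [k] := coh _ _ (top_face o fr) _ (top_boundary o fr pos).
have [n1 n2 n3 n4] := next_top o fr.
rewrite [map _ _]/= -/(top_vertices o u v w).
rewrite [X in rot k X](_ : _ = [seq l (segment x (next (top_vertices o u v w) x))
  | x <- top_vertices o u v w]) //.
rewrite {2}/top_vertices !map_cons n1 n2 n3 n4.
exact: sorted_rot_descents.
Qed.

Lemma no_coherent_box o u v w l : orthogonal_frame u v w ->
  0 < dot (cross u v) w -> ~ coherent_labelling (box o u v w) l.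
Proof.
move=> fr pos coh.
have eC p q : edge_label l p q = edge_label l q p.
  by rewrite /edge_label segmentC.
have rot_pos (a b c : 'rV[R]_3) : dot (cross b c) a = dot (cross a b) c.
  by rewrite !cross_dotE; ring.
have flip_pos (a b c : 'rV[R]_3) : dot (cross b a) (- c) = dot (cross a b) c.
  by rewrite !cross_dotE !mxE; ring.
have fr' := frame_rot fr; have fr'' := frame_rot fr'.
apply: (@no_coherent_corners _ _ eC o (o + u) (o + v) (o + u + v)
  (o + w) (o + u + w) (o + v + w) (o + u + v + w)).
- by apply: (@coherent_top _ _ o v w u _ _ _ _ coh);
    [rewrite box_rot|exact: fr'|rewrite rot_pos|vec..].
- by apply: (@coherent_top _ _ (o + u) w v (- u) _ _ _ _ coh);
    [rewrite box_rot box_flip|exact: frame_flip|rewrite flip_pos rot_pos|vec..].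
- by apply: (@coherent_top _ _ o w u v _ _ _ _ coh);
    [rewrite 2!box_rot|exact: fr''|rewrite 2!rot_pos|vec..].
- by apply: (@coherent_top _ _ (o + v) u w (- v) _ _ _ _ coh);
    [rewrite 2!box_rot box_flip|exact: frame_flip|
     rewrite flip_pos 2!rot_pos|vec..].
- by apply: (@coherent_top _ _ o u v w _ _ _ _ coh);
    [|exact: fr|exact: pos|vec..].
- by apply: (@coherent_top _ _ (o + w) v u (- w) _ _ _ _ coh);
    [rewrite box_flip|exact: frame_flip|rewrite flip_pos|vec..].
Qed.

End Box.

Theorem theorem7p1 (R : realType) (P : set 'rV[R]_3) (hP : is_cube P \/ is_cuboid P) :
  ~ exists l : set 'rV[R]_3 -> int, coherent_labelling P l.
Proof.
have [o [u [v [w [fr ->]]]]] : is_cuboid P.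
  by case: hP => // -[o [u [v [w [fr _ _ PE]]]]]; exists o, u, v, w.
move=> [l]; have := frame_triple_neq0 fr; rewrite neq_lt => /orP[neg|].
  (* A left-handed frame becomes right-handed when two vectors are swapped. *)
  rewrite box_swap; apply: no_coherent_box; first exact: frame_swap.
  by move: neg; rewrite !cross_dotE; lra.
exact: no_coherent_box.
Qed.
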